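(* There exist absolute constants $T_0>1$, $C>0$, $K>0$ and a real-valued function $\Delta=\Delta(y,T)$, defined for $y\ge 1$ and $T\ge T_0$, with $$\Big|\Delta(y,T)-\frac{y}{T}\Big|\le K\,\frac{y}{T^2},$$ such that for every Dirichlet polynomial $D(t)=\sum_n a_n n^{it}$ and every $T\ge T_0$, $$\int_{-T}^{T}|D(t)|^2\,dt\ \le\ C\left( T^2\int_{1}^{+\infty}\Big|\sum_{y-y/T\le n\le y+y/T}\Big(1-\frac{|n-y|}{y/T}\Big)a_n\Big|^2\frac{dy}{y}\ +\ \int_{1}^{+\infty}\Big(\sum_{y-\Delta\le n\le y+\Delta}|a_n|\Big)^2\frac{dy}{y}\right).$$
   Context: A Dirichlet polynomial is a finite sum $D(t)=\sum_n a_n n^{it}$ over positive integers $n$, with complex coefficients $a_n$ (only finitely many nonzero) and real $t$. All inner sums are over positive integers $n$ in the indicated ranges. *)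

(* Defs.v *)
From HB Require Import structures.
From mathcomp Require Import all_boot all_order all_algebra.
From mathcomp Require Import complex.
From mathcomp Require Import all_classical all_reals all_analysis.

Set Implicit Arguments.
Unset Strict Implicit.
Unset Printing Implicit Defensive.

Import Order.TTheory GRing.Theory Num.Theory.
Import numFieldNormedType.Exports.

Local Open Scope classical_set_scope.
Local Open Scope ring_scope.
Local Open Scope complex_scope.

Section DirichletPolynomials.
Context {R : realType}.

(* The modulus as an element of R; the norm `|z| of R[i] lives in R[i]. *)
Definition modc (z : R[i]) : R := ComplexField.Normc.normc z.

(* n^{it} = exp(i t ln n); only used for n > 0. *)
Definition natpow_i (n : nat) (t : R) : R[i] :=
  cos (t * ln n%:R) +i* sin (t * ln n%:R).

(* A coefficient sequence is a function on nat whose value at 0 is ignored. The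
   operator \sum_(n \in A) is the sum over a set with finitely many nonzero
   terms (it is 0 by convention otherwise), so it is meaningful here for
   coefficient sequences of finite support. *)
Definition fin_supp (a : nat -> R[i]) : Prop := finite_set [set n | a n != 0].

Definition dirichlet_poly (a : nat -> R[i]) (t : R) : R[i] :=
  \sum_(n \in [set n : nat | (0 < n)%N]) a n * natpow_i n t.

Definition window (y h : R) : set nat :=
  [set n : nat | (0 < n)%N /\ y - h <= n%:R <= y + h].

Definition tent_sum (a : nat -> R[i]) (y h : R) : R[i] :=
  \sum_(n \in window y h) (1 - `|n%:R - y| / h)%:C * a n.

Definition abs_sum (a : nat -> R[i]) (y h : R) : R :=
  \sum_(n \in window y h) modc (a n).

End DirichletPolynomials.

(* Main.v *)
Require Import Defs.
From HB Require Import structures.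
From mathcomp Require Import all_boot all_order all_algebra.
From mathcomp Require Import complex.
From mathcomp Require Import all_classical all_reals all_analysis.
From mathcomp Require Import measurable_realfun ring lra.

Set Implicit Arguments.
Unset Strict Implicit.
Unset Printing Implicit Defensive.

Import Order.TTheory GRing.Theory Num.Theory.
Import numFieldNormedType.Exports.

Local Open Scope classical_set_scope.
Local Open Scope ring_scope.

(**
Substituting y = e^u, the tent weight 1 - |n - y| / (y / T) becomes a function
of u - ln n only, so the smoothed sum is F(u) = sum_n a_n tent(u - ln n), and
its Fourier transform at t is D(t) times that of the tent, which is at least
1 / (12 T) for |t| <= T because |t v| <= T / (T - 1) on the support of the tent.
Instead of Plancherel's theorem we use Bessel's inequality on an interval of
length L = pi N / T containing the support of F, for the frequencies s + k d
with d = 2 pi / L: as s runs over an interval of length d these frequencies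
sweep [-T, T] once, and d L = 2 pi.  Real and imaginary parts of the
coefficients are treated separately.  The part u < 0 of the integral of F^2 only
sees n = 1, and is bounded by the part of the same tent with u > 0.  Hence the
first integral alone controls the mean square, and Delta(y, T) = y / T will do.
*)

(** * Integration of continuous real functions over segments *)

Section SegmentIntegral.
Context {R : realType}.
Implicit Types (f g : R -> R) (a b c : R).

(** Real-valued, so that [ring] and [lra] apply to relations between integrals; [segintE] leads back
    to extended reals. *)
Definition segint a b f : R := \int[lebesgue_measure]_(x in `[a, b]) f x.

Lemma continuous_integrable_itv a b f : continuous f ->
  lebesgue_measure.-integrable `[a, b] (EFin \o f).
Proof.
move=> cf; apply: continuous_compact_integrable; first exact: segment_compact.
exact: continuous_subspaceT.
Qed.

Lemma eq_segint a b f g : {in `[a, b], f =1 g} -> segint a b f = segint a b g.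
Proof. by move=> fg; apply: eq_Rintegral => x; rewrite inE => /fg. Qed.

Lemma segintE a b f : continuous f ->
  (segint a b f)%:E = (\int[lebesgue_measure]_(x in `[a, b]) (f x)%:E)%E.
Proof.
move=> cf; rewrite /segint /Rintegral fineK//.
by apply: integrable_fin_num => //; exact: continuous_integrable_itv.
Qed.

Lemma segintD a b f g : continuous f -> continuous g ->
  segint a b (fun x => f x + g x) = segint a b f + segint a b g.
Proof. by move=> cf cg; apply: RintegralD => //; exact: continuous_integrable_itv. Qed.

Lemma segintZ a b r f : continuous f ->
  segint a b (fun x => r * f x) = r * segint a b f.
Proof. by move=> cf; apply: RintegralZl => //; exact: continuous_integrable_itv. Qed.

Lemma continuous_sum (I : Type) (s : seq I) (P : pred I) (f : I -> R -> R) :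
  (forall i, P i -> continuous (f i)) ->
  continuous (fun x => \sum_(i <- s | P i) f i x).
Proof.
move=> cf; elim: s => [|i s IHs].
  rewrite (_ : (fun x => _) = fun=> 0); first exact: cst_continuous.
  by apply/funext => x; rewrite big_nil.
rewrite (_ : (fun x => _) = fun x =>
    if P i then f i x + \sum_(j <- s | P j) f j x else \sum_(j <- s | P j) f j x).
  2: by apply/funext => x; rewrite big_cons.
case Pi : (P i) => // x.
by apply: cvgD; [exact: cf|exact: IHs].
Qed.

Lemma segint_sum a b (I : Type) (s : seq I) (P : pred I) (f : I -> R -> R) :
  (forall i, P i -> continuous (f i)) ->
  segint a b (fun x => \sum_(i <- s | P i) f i x) =
  \sum_(i <- s | P i) segint a b (f i).
Proof.
move=> cf; elim: s => [|i s IHs].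
  (* [segint_cst] asks for [a <= b], which is absent here; writing 0 as [0 * 0] lets [segintZ] pull
     out a zero factor instead. *)
  rewrite big_nil (@eq_segint _ _ _ (fun=> 0 * 0)); last first.
    by move=> x _; rewrite big_nil mul0r.
  by rewrite segintZ ?mul0r//; exact: cst_continuous.
rewrite big_cons -IHs; case: ifP => Pi; last first.
  by apply: eq_segint => x _; rewrite big_cons Pi.
rewrite -segintD; [|exact: cf|exact: continuous_sum].
by apply: eq_segint => x _; rewrite big_cons Pi.
Qed.

Lemma ler_segint a b f g : continuous f -> continuous g ->
  (forall x, a <= x <= b -> f x <= g x) -> segint a b f <= segint a b g.
Proof.
move=> cf cg fg; by apply: le_Rintegral => //; exact: continuous_integrable_itv.
Qed.

Lemma segint_ge0 a b f : (forall x, a <= x <= b -> 0 <= f x) ->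
  0 <= segint a b f.
Proof.
by move=> f0; apply: Rintegral_ge0 => x /=; rewrite in_itv/= => /f0.
Qed.

Lemma segint_cst a b r : a <= b -> segint a b (fun=> r) = r * (b - a).
Proof.
move=> ab; rewrite /segint Rintegral_cst//= lebesgue_measure_itv/= lte_fin.
move: ab; rewrite le_eqVlt => /predU1P[->|->//].
by rewrite ltxx subrr.
Qed.

Lemma segint_split a b c f : continuous f -> a <= b -> b <= c ->
  segint a c f = segint a b f + segint b c f.
Proof.
move=> cf ab bc; apply/eqP; rewrite addrC -subr_eq; apply/eqP.
rewrite /segint Rintegral_itvB ?bnd_simp//; last exact: continuous_integrable_itv.
rewrite Rintegral_itv_obnd_cbnd//.
have := @continuous_integrable_itv b c f cf.
by apply: integrableS => //; apply: subset_itvr; rewrite bnd_simp.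
Qed.

Lemma segint_support a b a' b' f : continuous f ->
  a <= a' -> a' <= b' -> b' <= b ->
  (forall x, ~~ (a' < x < b') -> f x = 0) -> segint a b f = segint a' b' f.
Proof.
move=> cf aa ab bb f0.
rewrite (@segint_split a a' b)//; last exact: le_trans bb.
rewrite (@segint_split a' b' b)//.
rewrite (@eq_segint a a' f (fun=> 0)) => [|x]; last first.
  by rewrite in_itv/= => /andP[_ xa]; rewrite f0// ltNge xa.
rewrite (@eq_segint b' b f (fun=> 0)) => [|x]; last first.
  by rewrite in_itv/= => /andP[bx _]; rewrite f0// andbC ltNge bx.
by rewrite !segint_cst// !mul0r add0r addr0.
Qed.

Lemma segint_FTC a b f (F : R -> R) : a <= b -> continuous f ->
  (forall x : R, is_derive x (1 : R) F (f x)) -> segint a b f = F b - F a.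
Proof.
rewrite le_eqVlt => /predU1P[<- _ _|ab cf dF].
  by rewrite subrr /segint set_itv1 Rintegral_set1.
apply: EFin_inj; rewrite segintE// EFinB.
have cF : continuous F.
  by move=> x; apply/differentiable_continuous/derivable1_diffP; case: (dF x).
apply: continuous_FTC2 => //.
- exact: continuous_subspaceT.
- split=> [x _| |]; first by case: (dF x).
  + by apply: cvg_at_right_filter; exact: cF.
  + by apply: cvg_at_left_filter; exact: cF.
- by move=> x _; rewrite derive1E; case: (dF x).
Qed.

(** Stated for extended-real integrals because [g] is continuous only on the image segment: in the
    application y = e^u it carries a factor 1 / y. *)
Lemma segint_substitution a b (F f g : R -> R) : a <= b ->
  {homo F : x y / x < y} -> continuous f ->
  {within `[F a, F b], continuous g} ->
  (forall x : R, is_derive x (1 : R) F (f x)) ->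
  (\int[lebesgue_measure]_(y in `[F a, F b]) (g y)%:E =
   \int[lebesgue_measure]_(x in `[a, b]) (g (F x) * f x)%:E)%E.
Proof.
move=> ab iF cf cg dF.
have cF : continuous F.
  by move=> x; apply/differentiable_continuous/derivable1_diffP; case: (dF x).
have F'f : derive1 F = f by apply/funext => x; rewrite derive1E; case: (dF x).
rewrite integration_by_substitution_increasing// ?F'f//.
- by move=> x y _ _; exact: iF.
- by apply/cvg_ex; exists (f a); apply: cvg_at_right_filter; exact: cf.
- by apply/cvg_ex; exists (f b); apply: cvg_at_left_filter; exact: cf.
- split=> [x _| |]; first by case: (dF x).
  + by apply: cvg_at_right_filter; exact: cF.
  + by apply: cvg_at_left_filter; exact: cF.
Qed.

Lemma segint_shift a b c f : a <= b -> continuous f ->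
  segint (a + c) (b + c) f = segint a b (fun x => f (x + c)).
Proof.
move=> ab cf; apply: EFin_inj; rewrite !segintE//; last first.
  move=> x; apply: continuous_comp; last exact: cf.
  by apply: cvgD; [exact: cvg_id|exact: cvg_cst].
have dF (x : R) : is_derive x (1 : R) (fun y : R => y + c) 1.
  by apply: is_derive_eq; rewrite ?addr0.
have iF : {homo (fun y : R => y + c) : x y / x < y} by move=> x y; rewrite ltrD2r.
rewrite (segint_substitution ab iF _ _ dF).
- by apply: eq_integral => x _; rewrite mulr1.
- exact: cst_continuous.
- exact: continuous_subspaceT.
Qed.

(** Translating the N pieces to [0, d] makes it possible to bound an integral over [-T, T] offset by
    offset, with N equally spaced frequencies at a time. *)
Lemma segint_chop a (d : R) (N : nat) f : continuous f -> 0 <= d ->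
  segint a (a + N%:R * d) f =
  segint 0 d (fun x => \sum_(k < N) f (x + (a + k%:R * d))).
Proof.
move=> cf d0; rewrite segint_sum => [|k _]; last first.
  move=> x; apply: continuous_comp; last exact: cf.
  by apply: cvgD; [exact: cvg_id|exact: cvg_cst].
elim: N => [|N IHN].
  by rewrite mul0r addr0 big_ord0 /segint set_itv1 Rintegral_set1.
rewrite big_ord_recr/= -IHN (@segint_split a (a + N%:R * d)).
- congr (_ + _); rewrite -segint_shift//; congr segint; first by rewrite add0r.
  by rewrite -natr1; ring.
- exact: cf.
- by rewrite lerDl mulr_ge0.
- by rewrite lerD2l ler_wpM2r// ler_nat.
Qed.

End SegmentIntegral.

(** * Bessel's inequality for equally spaced frequencies on a segment *)

Section Bessel.
Context {R : realType}.
Implicit Types (f : R -> R) (a w s : R).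

Lemma continuous_cosM w : continuous (fun u : R => cos (w * u)).
Proof.
move=> u; apply: (@continuous_comp _ _ _ (fun u => w * u)).
  by apply: cvgM; [exact: cvg_cst|exact: cvg_id].
exact: continuous_cos.
Qed.

Lemma continuous_sinM w : continuous (fun u : R => sin (w * u)).
Proof.
move=> u; apply: (@continuous_comp _ _ _ (fun u => w * u)).
  by apply: cvgM; [exact: cvg_cst|exact: cvg_id].
exact: continuous_sin.
Qed.

Lemma continuousM_fun f g : continuous f -> continuous g ->
  continuous (fun u => f u * g u).
Proof. by move=> cf cg u; apply: cvgM; [exact: cf|exact: cg]. Qed.

Lemma continuousD_fun f g : continuous f -> continuous g ->
  continuous (fun u => f u + g u).
Proof. by move=> cf cg u; apply: cvgD; [exact: cf|exact: cg]. Qed.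

Lemma continuousZ_fun r f : continuous f -> continuous (fun u => r * f u).
Proof. by move=> cf; apply: continuousM_fun => // u; exact: cvg_cst. Qed.

Lemma is_derive_sinM w (x : R) :
  is_derive x (1 : R) (fun u : R => sin (w * u)) (w * cos (w * x)).
Proof.
have d : is_derive x (1 : R) (fun u : R => w * u) w.
  by apply: is_derive_eq; rewrite /GRing.scale/= mulr1 // mulr0 addr0.
apply: (@is_derive_eq _ _ _ _ _ _ _ _ (is_derive1_comp (f := sin) _ d)).
by rewrite mulrC.
Qed.

Lemma is_derive_cosM w (x : R) :
  is_derive x (1 : R) (fun u : R => cos (w * u)) (- w * sin (w * x)).
Proof.
have d : is_derive x (1 : R) (fun u : R => w * u) w.
  by apply: is_derive_eq; rewrite /GRing.scale/= mulr1 // mulr0 addr0.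
apply: (@is_derive_eq _ _ _ _ _ _ _ _ (is_derive1_comp (f := cos) _ d)).
by rewrite mulrC mulNr mulrN.
Qed.

(** Since d L = 2 pi, the frequency n d makes n full turns on the segment, so an antiderivative
    agrees at both ends. *)
Lemma segint_trig_period a (L d : R) (n : nat) : 0 < L -> d * L = pi *+ 2 ->
  (0 < n)%N ->
  segint a (a + L) (fun u => cos (n%:R * d * u)) = 0 /\
  segint a (a + L) (fun u => sin (n%:R * d * u)) = 0.
Proof.
move=> L0 dL n0; set w := n%:R * d.
have d0 : d != 0.
  by apply: contra_eq_neq dL => ->; rewrite mul0r eq_sym mulrn_eq0/= gt_eqF ?pi_gt0.
have w0 : w != 0 by rewrite mulf_neq0// pnatr_eq0 -lt0n.
have wL : w * (a + L) = w * a + (pi *+ 2) *+ n.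
  by rewrite mulrDr -[RHS](congr1 _ (mulr_natl (pi *+ 2) n)) -dL mulrA.
have aL : a <= a + L by rewrite lerDl ltW.
split.
- have dF (x : R) : is_derive x (1 : R) (w^-1 \*: (fun u => sin (w * u))) (cos (w * x)).
    apply: (@is_derive_eq _ _ _ _ _ _ _ _ (is_deriveZ w^-1 (is_derive_sinM w x))).
    by rewrite /GRing.scale/=; field.
  rewrite (segint_FTC aL _ dF); last exact: continuous_cosM.
  by rewrite /= wL (periodicn (@sinD2pi R)) subrr.
- have dF (x : R) :
      is_derive x (1 : R) (- w^-1 \*: (fun u => cos (w * u))) (sin (w * x)).
    apply: (@is_derive_eq _ _ _ _ _ _ _ _ (is_deriveZ (- w^-1) (is_derive_cosM w x))).
    by rewrite /GRing.scale/=; field.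
  rewrite (segint_FTC aL _ dF); last exact: continuous_sinM.
  by rewrite /= wL (periodicn (@cosD2pi R)) subrr.
Qed.

(** With t_k = s + k d and c_k the integral of f e^{-i t_k u}, expand the nonnegative integral of |L
    f - sum_k c_k e^{i t_k u}|^2; orthogonality turns it into L times the difference of the two
    sides. *)
Lemma segint_bessel f a (L d s : R) (N : nat) :
  continuous f -> 0 < L -> d * L = pi *+ 2 ->
  \sum_(k < N) (segint a (a + L) (fun u => f u * cos ((s + k%:R * d) * u)) ^+ 2 +
                segint a (a + L) (fun u => f u * sin ((s + k%:R * d) * u)) ^+ 2)
  <= L * segint a (a + L) (fun u => f u ^+ 2).
Proof.
move=> cf L0 dL.
pose t (k : 'I_N) := s + k%:R * d.
pose c k u := cos (t k * u); pose z k u := sin (t k * u).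
have cc k : continuous (c k) by exact: continuous_cosM.
have cz k : continuous (z k) by exact: continuous_sinM.
pose I := segint a (a + L).
pose al k := I (fun u => f u * c k u); pose be k := I (fun u => f u * z k u).
rewrite -/I; set S := (X in X <= _).
have SE : S = \sum_k (al k ^+ 2 + be k ^+ 2) by [].
clearbody S.
(* As c_k = [al k] - i [be k], the sum of c_k e^{i t_k u} is P - i Q. *)
pose P u := \sum_k (al k * c k u + be k * z k u).
pose Q u := \sum_k (be k * c k u - al k * z k u).
have cP : continuous P.
  by apply: continuous_sum => k _; apply: continuousD_fun; exact: continuousZ_fun.
have QE : Q = fun u => \sum_k (be k * c k u + (- al k) * z k u).
  by apply/funext => u; apply: eq_bigr => k _; rewrite mulNr.
have cQ : continuous Q.
  rewrite QE.
  by apply: continuous_sum => k _; apply: continuousD_fun; exact: continuousZ_fun.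
have IfP : I (fun u => f u * P u) = S.
  rewrite SE /I (_ : (fun u => _) =
      fun u => \sum_k (al k * (f u * c k u) + be k * (f u * z k u))); last first.
    by apply/funext => u; rewrite mulr_sumr; apply: eq_bigr => k _; ring.
  rewrite segint_sum => [|k _]; last first.
    by apply: continuousD_fun; apply: continuousZ_fun; exact: continuousM_fun.
  apply: eq_bigr => k _; rewrite segintD ?segintZ//;
    do ?apply: continuousZ_fun; exact: continuousM_fun.
(* Orthogonality of the exponentials, as the real and imaginary parts of e^{i (t_j - t_k) u}. *)
have orth (j k : 'I_N) :
    I (fun u => cos ((t j - t k) * u)) = L *+ (j == k) /\
    I (fun u => sin ((t j - t k) * u)) = 0.
  have [->|jk] := eqVneq j k.
    rewrite subrr; split.
      rewrite /I (@eq_segint _ _ _ _ (fun=> 1)) => [|u _]; last by rewrite mul0r cos0.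
      by rewrite segint_cst ?lerDl 1?ltW// mul1r addrC addKr.
    rewrite /I (@eq_segint _ _ _ _ (fun=> 0)) => [|u _]; last by rewrite mul0r sin0.
    by rewrite segint_cst ?lerDl 1?ltW// mul0r.
  rewrite mulr0n.
  (* [segint_trig_period] takes a positive natural multiple of d, so a negative difference is
     handled by the parity of cos and sin. *)
  have [lt_jk|le_kj] := ltnP j k.
    have [Ec Ez] := @segint_trig_period a L d (k - j) L0 dL ltac:(by rewrite subn_gt0).
    have tE : t j - t k = - ((k - j)%:R * d).
      by rewrite natrB 1?ltnW// /t; ring.
    split.
      rewrite -Ec /I; apply: eq_segint => u _.
      by rewrite tE mulNr cosN.
    rewrite /I (@eq_segint _ _ _ _ (fun u => -1 * sin ((k - j)%:R * d * u))).
      by rewrite segintZ ?Ez ?mulr0//; exact: continuous_sinM.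
    by move=> u _; rewrite tE mulN1r mulNr sinN.
  have [Ec Ez] := @segint_trig_period a L d (j - k) L0 dL
      ltac:(by rewrite subn_gt0 ltn_neqAle le_kj eq_sym jk).
  have tE : t j - t k = (j - k)%:R * d by rewrite natrB// /t; ring.
  by rewrite tE; split.
(* In the double sum for |P - i Q|^2 only the diagonal survives, each term with weight L. *)
have IPQ : I (fun u => P u ^+ 2 + Q u ^+ 2) = L * S.
  rewrite /I (_ : (fun u => _) = fun u => \sum_j \sum_k
     ((al j * al k + be j * be k) * cos ((t j - t k) * u) +
      (be j * al k - al j * be k) * sin ((t j - t k) * u))); last first.
    apply/funext => u; rewrite !expr2 /P /Q !big_distrlr -big_split/=.
    apply: eq_bigr => j _; rewrite -big_split; apply: eq_bigr => k _ /=.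
    by rewrite [(t j - t k) * u]mulrBl cosB sinB /c /z; ring.
  have cjk j k : continuous (fun u =>
      (al j * al k + be j * be k) * cos ((t j - t k) * u) +
      (be j * al k - al j * be k) * sin ((t j - t k) * u)).
    apply: continuousD_fun; apply: continuousZ_fun;
      [exact: continuous_cosM|exact: continuous_sinM].
  rewrite segint_sum; last by move=> j _; exact: continuous_sum.
  rewrite SE mulr_sumr; apply: eq_bigr => j _.
  rewrite segint_sum// (bigD1 j)//= [X in _ + X]big1 ?addr0 => [|k kj].
    rewrite segintD; do ?[apply: continuousZ_fun];
      [|exact: continuous_cosM|exact: continuous_sinM].
    rewrite !segintZ; [|exact: continuous_sinM|exact: continuous_cosM].
    have := orth j j; rewrite /I => -[-> ->]; rewrite eqxx mulr1n; ring.
  rewrite segintD; do ?[apply: continuousZ_fun];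
    [|exact: continuous_cosM|exact: continuous_sinM].
  rewrite !segintZ; [|exact: continuous_sinM|exact: continuous_cosM].
  by have := orth j k; rewrite /I => -[-> ->]; rewrite eq_sym (negbTE kj) !mulr0 addr0.
have cPQ : continuous (fun u => P u ^+ 2 + Q u ^+ 2).
  by apply: continuousD_fun; exact: continuousM_fun.
have cf2 : continuous (fun u => f u ^+ 2) by exact: continuousM_fun.
have cfP : continuous (fun u => f u * P u) by exact: continuousM_fun.
have : 0 <= I (fun u => (L ^+ 2 * f u ^+ 2 + (- 2 * L) * (f u * P u))
                          + (P u ^+ 2 + Q u ^+ 2)).
  apply: segint_ge0 => u _.
  have -> : (L ^+ 2 * f u ^+ 2 + (- 2 * L) * (f u * P u)) + (P u ^+ 2 + Q u ^+ 2)
     = (L * f u - P u) ^+ 2 + Q u ^+ 2 by ring.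
  by rewrite addr_ge0// sqr_ge0.
rewrite /I segintD//; last by apply: continuousD_fun; exact: continuousZ_fun.
rewrite segintD; try exact: continuousZ_fun.
rewrite !segintZ// -/I IPQ IfP.
have -> : L ^+ 2 * I (fun u => f u ^+ 2) + - 2 * L * S + L * S =
   L * (L * I (fun u => f u ^+ 2) - S) by ring.
by rewrite pmulr_rge0// subr_ge0.
Qed.

End Bessel.

(** * The tent kernel in logarithmic scale and its Fourier transform *)

Section Tent.
Context {R : realType}.
Implicit Types (u v t l T : R).

(** Integrate -1 <= cos <= 1 from 0 to x. *)
Lemma normr_sin_le (x : R) : 0 <= x -> `|sin x| <= x.
Proof.
move=> x0; have := @segint_FTC R 0 x _ _ x0 (@continuous_cos R) (@is_derive_sin R).
rewrite sin0 subr0 => <-; have cc := @continuous_cos R.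
have c1 (r : R) : continuous (fun _ : R => r) by exact: cst_continuous.
rewrite ler_norml; apply/andP; split.
  have -> : - x = segint 0 x (fun=> -1) by rewrite segint_cst// subr0 mulN1r.
  by apply: ler_segint => // y _; exact: cos_geN1.
have {2}-> : x = segint 0 x (fun=> 1) by rewrite segint_cst// subr0 mul1r.
by apply: ler_segint => // y _; exact: cos_le1.
Qed.

(** Half-angle formula: cos x = 1 - 2 sin^2 (x / 2), with |sin (x / 2)| <= x / 2 for x >= 0. *)
Lemma cos_ge_quadratic (x : R) : 1 - x ^+ 2 / 2 <= cos x.
Proof.
wlog x0 : x / 0 <= x => [H|].
  have [/H//|/ltW x0] := leP 0 x; have := H (- x).
  by rewrite sqrrN cosN oppr_ge0; apply.
have -> : 1 - x ^+ 2 / 2 = 1 - 2 * (x / 2) ^+ 2 by field.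
have -> : cos x = 1 - 2 * sin (x / 2) ^+ 2.
  by rewrite {1}(_ : x = (x / 2) *+ 2) 1?cos_mulr2n ?cos2sin2; [ring|field].
rewrite lerD2l lerN2 ler_wpM2l//.
have x20 : 0 <= x / 2 by rewrite divr_ge0.
by rewrite -(real_normK (num_real (sin _))) lerXn2r ?nnegrE// normr_sin_le.
Qed.

(** At v = ln y - ln n one has e^{-v} = n / y, so this is the weight 1 - |n - y| / (y / T), cut off
    at 0. *)
Definition tent T v : R := Num.max 0 (1 - T * `|expR (- v) - 1|).

Lemma continuous_tent T : continuous (tent T).
Proof.
move=> v; apply: (@continuous_max _ _ (fun=> 0 : R) (fun v => 1 - T * `|expR (- v) - 1|)).
  exact: cst_continuous.
apply: cvgB; first exact: cvg_cst.
apply: cvgM; first exact: cvg_cst.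
apply: cvg_norm; apply: cvgB; last exact: cvg_cst.
apply: (@continuous_comp _ _ _ (fun v : R => - v) expR); last exact: continuous_expR.
exact: cvgN.
Qed.

Lemma tent_ge0 T v : 0 <= tent T v.
Proof. by rewrite le_max lexx. Qed.

Lemma tent_le1 T v : 0 <= T -> tent T v <= 1.
Proof. by move=> T0; rewrite ge_max ler01 gerBl mulr_ge0. Qed.

Lemma tent_eq0 T v : 1 <= T * `|expR (- v) - 1| -> tent T v = 0.
Proof. by move=> h; apply/max_idPl; rewrite subr_le0. Qed.

Lemma tent_ge T v r : T * `|expR (- v) - 1| <= r -> 1 - r <= tent T v.
Proof. by move=> h; rewrite le_max lerD2l lerN2 h orbT. Qed.

(** Both ends come from e^w >= 1 + w: with w = -v on the left, and with w = v on the right after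
    multiplying T - 1 < T e^{-v} by e^v. *)
Lemma tent_neq0 T v : 1 < T -> tent T v != 0 -> - T^-1 < v < (T - 1)^-1.
Proof.
move=> T1 /eqP tn0; have T0 : 0 < T by lra.
have : T * `|expR (- v) - 1| < 1 by rewrite ltNge; apply/negP => /tent_eq0.
rewrite mulrC -ltr_pdivlMr// div1r ltr_norml => /andP[h1 h2].
have e1 := expR_ge1Dx (- v); have e2 := expR_ge1Dx v.
apply/andP; split; first lra.
have Ti : T^-1 * T = 1 by rewrite mulVf// gt_eqF.
have ev : expR v * expR (- v) = 1 by rewrite expRxMexpNx_1.
have p := expR_gt0 v.
rewrite -div1r ltr_pdivlMr; last lra.
have : (T - 1) < T * expR (- v).
  have : (1 - T^-1) * T < expR (- v) * T by rewrite ltr_pM2r//; lra.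
  by rewrite mulrBl Ti mul1r mulrC.
rewrite -(ltr_pM2l p) mulrCA ev mulr1 => h3.
have : (1 + v) * (T - 1) <= expR v * (T - 1) by rewrite ler_wpM2r//; lra.
lra.
Qed.

Lemma tent_support T v : 2 <= T -> ~~ (-1 < v < 1) -> tent T v = 0.
Proof.
move=> T2; have T1 : 1 < T by lra.
apply: contraNeq => /(tent_neq0 T1)/andP[h1 h2].
have a1 : T^-1 <= 1 by rewrite invf_le1//; lra.
have a2 : (T - 1)^-1 <= 1 by rewrite invf_le1; lra.
by apply/andP; split; lra.
Qed.

Lemma tent_ge_half T v : 0 < T -> 0 <= v <= (2 * T)^-1 -> 1 / 2 <= tent T v.
Proof.
move=> T0 /andP[v0 vT]; rewrite (_ : 1 / 2 = 1 - 1 / 2); last by field.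
apply: tent_ge; rewrite ler0_norm ?subr_le0 ?expR_le1 ?oppr_le0//.
have := expR_ge1Dx (- v) => e.
have : T * v <= 1 / 2.
  rewrite mulrC -ler_pdivlMr//; apply: le_trans vT _.
  by rewrite div1r invfM.
have : T * (- (expR (- v) - 1)) <= T * v by rewrite ler_wpM2l//; lra.
lra.
Qed.

(** Together with [tent_sin], the real and imaginary parts of the Fourier transform of the tent
    (kernel e^{i t v}); [-1, 1] contains the support once T >= 2. *)
Definition tent_cos T t := segint (-1) 1 (fun v => tent T v * cos (t * v)).
Definition tent_sin T t := segint (-1) 1 (fun v => tent T v * sin (t * v)).

(** On the support the cosine stays above 1/3, and the tent has mass at least 1 / (4 T). *)
Lemma tent_cos_ge T t : 11 <= T -> `|t| <= T -> (12 * T)^-1 <= tent_cos T t.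
Proof.
move=> T11 tT; have T0 : 0 < T by lra.
have T1 : 1 < T by lra.
have ct := @continuous_tent T.
have step v : -1 <= v <= 1 -> 1 / 3 * tent T v <= tent T v * cos (t * v).
  move=> _; rewrite mulrC; have [->|tv0] := eqVneq (tent T v) 0; first by rewrite !mul0r.
  apply: ler_wpM2l; first exact: tent_ge0.
  apply: le_trans (cos_ge_quadratic _).
  have /andP[h1 h2] := tent_neq0 T1 tv0.
  have vb : `|v| <= (T - 1)^-1.
    rewrite ler_norml (ltW h2) andbT (le_trans _ (ltW h1))// lerN2.
    by rewrite lef_pV2 ?posrE; lra.
  have tvb : `|t * v| <= 11 / 10.
    rewrite normrM (le_trans (ler_pM _ _ tT vb))// ler_pdivrMr; lra.
  (* The quadratic bound then gives cos >= 1 - 1.21 / 2 = 0.395 > 1/3; the value 11/10 is T / (T -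
     1) at T = 11. *)
  have : (t * v) ^+ 2 <= (11 / 10) ^+ 2.
    by rewrite -(real_normK (num_real (t * v))) lerXn2r// nnegrE; lra.
  lra.
have b01 : 0 <= (2 * T)^-1 by rewrite invr_ge0; lra.
have b1 : (2 * T)^-1 <= 1 by rewrite invf_le1; lra.
apply: le_trans (ler_segint (f := fun v => 1 / 3 * tent T v) _ _ step).
- rewrite segintZ// (@segint_split _ (-1) 0 1) ?lerN10 ?ler01//.
  rewrite (@segint_split _ 0 (2 * T)^-1 1)//.
  have i1 : 0 <= segint (-1) 0 (tent T) by apply: segint_ge0 => v _; exact: tent_ge0.
  have i2 : 0 <= segint (2 * T)^-1 1 (tent T) by apply: segint_ge0 => v _; exact: tent_ge0.
  (* The tent is at least 1/2 on a segment of length 1 / (2 T). *)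
  have i3 : (4 * T)^-1 <= segint 0 (2 * T)^-1 (tent T).
    have -> : (4 * T)^-1 = segint 0 (2 * T)^-1 (fun=> 1 / 2).
      by rewrite segint_cst// subr0; field; rewrite gt_eqF.
    by apply: ler_segint => // [|v vb]; [exact: cst_continuous|exact: tent_ge_half].
  have -> : (12 * T)^-1 = 1 / 3 * (4 * T)^-1 by field; rewrite gt_eqF.
  by rewrite ler_wpM2l//; lra.
- exact: continuousZ_fun.
- by apply: continuousM_fun => //; exact: continuous_cosM.
Qed.

(** Translation by l multiplies the transform by e^{i t l}. *)
Lemma segint_tent_shift T t l (a b : R) : 2 <= T -> a <= l - 1 -> l + 1 <= b ->
  segint a b (fun u => tent T (u - l) * cos (t * u)) =
    cos (t * l) * tent_cos T t - sin (t * l) * tent_sin T t /\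
  segint a b (fun u => tent T (u - l) * sin (t * u)) =
    sin (t * l) * tent_cos T t + cos (t * l) * tent_sin T t.
Proof.
move=> T2 al lb.
have ct := @continuous_tent T.
have cs : continuous (fun u => tent T (u - l)).
  move=> u; apply: (@continuous_comp _ _ _ (fun u => u - l)); last exact: ct.
  by apply: cvgB; [exact: cvg_id|exact: cvg_cst].
have cc := continuousM_fun ct (@continuous_cosM R t).
have cz := continuousM_fun ct (@continuous_sinM R t).
have supp (w : R -> R) : continuous w ->
    segint a b (fun u => tent T (u - l) * w u) =
    segint (-1) 1 (fun v => tent T v * w (v + l)).
  move=> cw; rewrite (@segint_support _ _ _ (-1 + l) (1 + l)); first last.
  - move=> x xl; rewrite tent_support ?mul0r//.
    by apply: contra xl => /andP[? ?]; apply/andP; split; lra.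
  - lra.
  - lra.
  - lra.
  - exact: continuousM_fun.
  rewrite segint_shift; last exact: continuousM_fun; last by lra.
  by apply: eq_segint => v _; rewrite addrK.
split.
- rewrite supp; last exact: continuous_cosM.
  rewrite -mulNr -!segintZ// -segintD; try exact: continuousZ_fun.
  by apply: eq_segint => v _; rewrite mulrDr cosD; ring.
- rewrite supp; last exact: continuous_sinM.
  rewrite -!segintZ// -segintD; try exact: continuousZ_fun.
  by apply: eq_segint => v _; rewrite mulrDr sinD; ring.
Qed.

End Tent.

(** * Mean square of Dirichlet polynomials with real coefficients *)

Section MeanSquare.
Context {R : realType}.
Variables (T : R) (m : nat).
Implicit Types (x : nat -> R) (t u b : R).

(** The index i stands for the integer n = i + 1, here and in the two sums below, which are the real
    and imaginary parts of sum_n x_n n^{it}. *)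
Definition tent_series x u : R :=
  \sum_(i < m.+1) x i * tent T (u - ln i.+1%:R).

Definition cos_poly x t : R := \sum_(i < m.+1) x i * cos (t * ln i.+1%:R).
Definition sin_poly x t : R := \sum_(i < m.+1) x i * sin (t * ln i.+1%:R).

Lemma continuous_tent_series x : continuous (tent_series x).
Proof.
apply: continuous_sum => i _; apply: continuousZ_fun => u.
apply: (@continuous_comp _ _ _ (fun u => u - ln i.+1%:R)); last exact: continuous_tent.
by apply: cvgB; [exact: cvg_id|exact: cvg_cst].
Qed.

Lemma continuous_cos_poly x : continuous (cos_poly x).
Proof.
apply: continuous_sum => i _; apply: continuousZ_fun.
rewrite (_ : (fun t => _) = fun t => cos (ln i.+1%:R * t)); last first.
  by apply/funext => t; rewrite mulrC.
exact: continuous_cosM.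
Qed.

Lemma continuous_sin_poly x : continuous (sin_poly x).
Proof.
apply: continuous_sum => i _; apply: continuousZ_fun.
rewrite (_ : (fun t => _) = fun t => sin (ln i.+1%:R * t)); last first.
  by apply/funext => t; rewrite mulrC.
exact: continuous_sinM.
Qed.

Lemma ln_index_bounds (i : 'I_m.+1) : 0 <= ln (i.+1%:R : R) <= ln m.+1%:R.
Proof. by rewrite ln_ge0 ?ler1n//= ler_ln ?posrE ?ltr0n// ler_nat ltn_ord. Qed.

(** The shift rule applied term by term: the transform of the series is the Dirichlet polynomial
    times the transform of the tent. *)
Lemma fourier_tent_series x t b : 2 <= T -> ln m.+1%:R + 1 <= b ->
  segint (-1) b (fun u => tent_series x u * cos (t * u)) =
    cos_poly x t * tent_cos T t - sin_poly x t * tent_sin T t /\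
  segint (-1) b (fun u => tent_series x u * sin (t * u)) =
    sin_poly x t * tent_cos T t + cos_poly x t * tent_sin T t.
Proof.
move=> T2 hb.
have ct (i : 'I_m.+1) : continuous (fun u => tent T (u - ln i.+1%:R)).
  move=> u.
  apply: (@continuous_comp _ _ _ (fun u => u - ln i.+1%:R)); last exact: continuous_tent.
  by apply: cvgB; [exact: cvg_id|exact: cvg_cst].
have lin (w : R -> R) : continuous w ->
    segint (-1) b (fun u => tent_series x u * w u) =
    \sum_(i < m.+1) x i * segint (-1) b (fun u => tent T (u - ln i.+1%:R) * w u).
  move=> cw; have cti i := continuousM_fun (ct i) cw.
  rewrite (@eq_segint _ _ _ _ (fun u =>
      \sum_(i < m.+1) x i * (tent T (u - ln i.+1%:R) * w u))).
    rewrite segint_sum => [|i _]; last exact: continuousZ_fun.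
    by apply: eq_bigr => i _; rewrite segintZ.
  by move=> u _; rewrite mulr_suml; apply: eq_bigr => i _; rewrite mulrA.
have sh (i : 'I_m.+1) := @segint_tent_shift R T t (ln i.+1%:R) (-1) b T2.
have bnd (i : 'I_m.+1) : -1 <= ln i.+1%:R - 1 :> R /\ ln i.+1%:R + 1 <= b.
  by have /andP[? ?] := ln_index_bounds i; split; lra.
split.
- rewrite lin; last exact: continuous_cosM.
  rewrite !mulr_suml -sumrB; apply: eq_bigr => i _.
  by have [h1 h2] := bnd i; have [-> _] := sh i h1 h2; ring.
- rewrite lin; last exact: continuous_sinM.
  rewrite !mulr_suml -big_split; apply: eq_bigr => i _.
  by have [h1 h2] := bnd i; have [_ ->] := sh i h1 h2; rewrite /=; ring.
Qed.

Lemma mean_square_le x (N : nat) : 11 <= T -> (0 < N)%N ->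
  ln m.+1%:R + 2 <= pi * N%:R / T ->
  segint (-T) T (fun t => cos_poly x t ^+ 2 + sin_poly x t ^+ 2) <=
  288 * pi * T ^+ 2 *
    segint (-1) (-1 + pi * N%:R / T) (fun u => tent_series x u ^+ 2).
Proof.
move=> T11 N0; set L := pi * N%:R / T => hL.
have T2 : 2 <= T by lra.
have T0 : 0 < T by lra.
have NR0 : 0 < N%:R :> R by rewrite ltr0n.
have p0 : 0 < pi :> R by exact: pi_gt0.
have L0 : 0 < L by rewrite divr_gt0// mulr_gt0.
pose d := 2 * T / N%:R.
have d0 : 0 < d by rewrite divr_gt0// mulr_gt0.
have dL : d * L = pi *+ 2 by rewrite /d /L -mulr_natl; field; rewrite !gt_eqF.
have NdT : N%:R * d = 2 * T by rewrite /d; field; rewrite gt_eqF.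
pose g t := cos_poly x t ^+ 2 + sin_poly x t ^+ 2.
have cg : continuous g.
  by apply: continuousD_fun; apply: continuousM_fun;
    solve [exact: continuous_cos_poly|exact: continuous_sin_poly].
set I := segint (-1) _ _.
have cF := @continuous_tent_series x.
(* For a fixed offset th all frequencies th - T + k d lie in [-T, T], where each Bessel term is at
   least |D(t)|^2 / (12 T)^2. *)
have bound th : 0 <= th <= d ->
    \sum_(k < N) g (th + (- T + k%:R * d)) <= L * (144 * T ^+ 2) * I.
  move=> /andP[th0 thd].
  have := @segint_bessel R (tent_series x) (-1) L d (th - T) N cF L0 dL.
  rewrite -/I => B.
  have : (144 * T ^+ 2)^-1 * \sum_(k < N) g (th + (- T + k%:R * d)) <= L * I.
    apply: le_trans B; rewrite mulr_sumr; apply: ler_sum => k _.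
    rewrite addrA; set t := th - T + _.
    have tT : `|t| <= T.
      have : k%:R * d <= N%:R * d - d.
        rewrite -[X in _ - X]mul1r -mulrBl ler_wpM2r//; first exact: ltW.
        by rewrite lerBrDr natr1 ler_nat.
      have : 0 <= k%:R * d by rewrite mulr_ge0// ltW.
      by rewrite NdT ler_norml => ? ?; apply/andP; split; rewrite /t; lra.
    (* The 2 in [hL] splits into one unit for the start at -1 and one for the half-width allotted to
       the last tent. *)
    have hb : ln m.+1%:R + 1 <= -1 + L by lra.
    have [-> ->] := fourier_tent_series x t T2 hb.
    (* Multiplicativity of the squared modulus; of the factor c^2 + s^2 only the cosine part is then
       kept. *)
    have -> (p q c s : R) : (p * c - q * s) ^+ 2 + (q * c + p * s) ^+ 2 =
        (p ^+ 2 + q ^+ 2) * (c ^+ 2 + s ^+ 2) by ring.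
    rewrite mulrC ler_wpM2l ?addr_ge0 ?sqr_ge0//.
    rewrite ler_wpDr ?sqr_ge0//.
    have -> : (144 * T ^+ 2)^-1 = (12 * T)^-1 ^+ 2 by field; rewrite gt_eqF.
    have h := tent_cos_ge T11 tT.
    have h0 : 0 <= (12 * T)^-1 by rewrite invr_ge0; lra.
    by rewrite lerXn2r// nnegrE// (le_trans h0).
  rewrite ler_pdivrMl ?mulr_gt0 ?exprn_gt0// => /le_trans; apply.
  by rewrite le_eqVlt -subr_eq0; apply/orP; left; apply/eqP; ring.
have -> : segint (- T) T g =
    segint 0 d (fun th => \sum_(k < N) g (th + (- T + k%:R * d))).
  rewrite -segint_chop ?(ltW d0)// NdT.
  by congr segint; ring.
(* Here 144 = 12^2 and d L = 2 pi, whence 288 pi. *)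
have -> : 288 * pi * T ^+ 2 * I = L * (144 * T ^+ 2) * I * (d - 0).
  by rewrite subr0 (_ : _ * d = 144 * T ^+ 2 * I * (d * L)); [rewrite dL -mulr_natl; ring|ring].
rewrite -segint_cst ?(ltW d0)//; apply: ler_segint => //.
- apply: continuous_sum => k _ t; apply: (@continuous_comp _ _ _ (fun t => t + _));
    last exact: cg.
  by apply: cvgD; [exact: cvg_id|exact: cvg_cst].
- exact: cst_continuous.
Qed.

(** For n >= 2, T (n e^{-u} - 1) >= T (1 - 2 u) >= T - 1 >= 1, so these tents vanish at u. *)
Lemma tent_series_near0 x u : 2 <= T -> -1 <= u <= (2 * T)^-1 ->
  tent_series x u = x 0%N * tent T u.
Proof.
move=> T2 /andP[u1 uT]; have T0 : 0 < T by lra.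
rewrite /tent_series big_ord_recl/= big1 ?addr0 ?ln1 ?subr0// => i _.
rewrite tent_eq0 ?mulr0// /bump/= add1n.
rewrite opprB expRB lnK ?posrE ?ltr0n//.
have ge2 : 2 <= i.+2%:R :> R by rewrite ler_nat.
have := expR_ge1Dx (- u) => e.
rewrite -expRN.
have Tu : T * (2 * T)^-1 = 1 / 2 by field; rewrite gt_eqF.
have uT1 : T * u <= 1 / 2 by rewrite -Tu ler_wpM2l// ltW.
have h1 : 2 * expR (- u) <= i.+2%:R * expR (- u) by rewrite ler_wpM2r// expR_ge0.
apply: (@le_trans _ _ (T * (i.+2%:R * expR (- u) - 1))); last first.
  by rewrite ler_wpM2l ?ler_norm// ltW.
apply: (@le_trans _ _ (T * (1 - 2 * u))); first lra.
by rewrite ler_wpM2l; lra.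
Qed.

(** Only n = 1 is seen on [-1, 0], with energy at most x_0^2 / T, while its tent already gives x_0^2
    / (8 T) on [0, 1 / (2 T)]; hence 9 = 8 + 1. *)
Lemma segint_tent_series_neg x b : 2 <= T -> 1 <= b ->
  segint (-1) b (fun u => tent_series x u ^+ 2) <=
  9 * segint 0 b (fun u => tent_series x u ^+ 2).
Proof.
move=> T2 b1; have T1 : 1 < T by lra.
have T0 : 0 < T by lra.
have cF := @continuous_tent_series x.
have cF2 : continuous (fun u => tent_series x u ^+ 2) by exact: continuousM_fun.
have Ti0 : 0 < T^-1 by rewrite invr_gt0.
have Ti1 : T^-1 <= 1 by rewrite invf_le1//; lra.
have T2i0 : 0 < (2 * T)^-1 by rewrite invr_gt0; lra.
have T2i1 : (2 * T)^-1 <= 1 by rewrite invf_le1//; lra.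
rewrite (@segint_split _ (-1) 0 b) ?lerN10//; last lra.
set J := segint 0 b _.
suff : segint (-1) 0 (fun u => tent_series x u ^+ 2) <= 8 * J by lra.
(* On the negative side the tent is at most 1 and lives on a segment of length 1 / T. *)
apply: (@le_trans _ _ (x 0%N ^+ 2 * T^-1)).
  rewrite (@segint_split _ (-1) (- T^-1) 0) ?lerN2 ?oppr_le0 ?(ltW Ti0)//.
  rewrite (@eq_segint _ _ (- T^-1) _ (fun=> 0)) => [|u]; last first.
    rewrite in_itv/= => /andP[u1 u2].
    rewrite tent_series_near0//; last by apply/andP; split; lra.
    have -> : tent T u = 0.
      by apply/eqP; apply: contraT => /(tent_neq0 T1)/andP[h _]; lra.
    by rewrite mulr0 expr0n.
  rewrite segint_cst ?mul0r ?add0r; last by rewrite lerN2.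
  have -> : x 0%N ^+ 2 * T^-1 = segint (- T^-1) 0 (fun=> x 0%N ^+ 2).
    by rewrite segint_cst ?sub0r ?opprK// oppr_le0 ltW.
  apply: ler_segint => // [|u /andP[u1 u2]]; first exact: cst_continuous.
  rewrite tent_series_near0//; last by apply/andP; split; lra.
  rewrite exprMn ler_piMr ?sqr_ge0// expr_le1// ?tent_ge0// tent_le1//; lra.
(* The factor 8 is the inverse of (1/2)^2 times 1/2: a squared height of at least 1/4 over a length
   1 / (2 T). *)
have -> : x 0%N ^+ 2 * T^-1 = 8 * segint 0 (2 * T)^-1 (fun=> x 0%N ^+ 2 * (1 / 2) ^+ 2).
  by rewrite segint_cst ?(ltW T2i0)//; field; rewrite gt_eqF.
rewrite ler_wpM2l// /J (@segint_split _ 0 (2 * T)^-1 b) ?(ltW T2i0)//; last lra.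
rewrite ler_wpDr//; first by apply: segint_ge0 => u _; exact: sqr_ge0.
apply: ler_segint => // [|u /andP[u1 u2]]; first exact: cst_continuous.
rewrite tent_series_near0//; last by apply/andP; split; lra.
rewrite [(x 0%N * _) ^+ 2]exprMn ler_wpM2l ?sqr_ge0// lerXn2r ?nnegrE ?tent_ge0//.
by rewrite tent_ge_half// u1 u2.
Qed.

End MeanSquare.

(** * From the complex sums of the statement to real series *)

Section DirichletTent.
Local Open Scope complex_scope.
Context {R : realType}.
Implicit Types (a : nat -> R[i]) (y t T : R).

Lemma fin_supp_bound a : fin_supp a -> exists m, forall n, (m < n)%N -> a n = 0.
Proof.
move=> /finite_seqP[r aE]; exists (\max_(i <- r) i)%N => n mn.
apply/eqP; apply: contraTT mn => an0; rewrite -leqNgt.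
apply: (@leq_bigmax_seq _ _ xpredT id) => //.
by have : [set n | a n != 0] n by []; rewrite aE.
Qed.

(** As 0 is outside [P], shifting the index by one turns the finitely supported sum into one over
    ordinals. *)
Lemma fsum_positive (V : zmodType) (P : set nat) (G : nat -> V) M :
  ~ P 0%N -> (forall n, (M < n)%N -> G n = 0) ->
  \sum_(n \in P) G n = \sum_(i < M) if i.+1 \in P then G i.+1 else 0.
Proof.
move=> P0 G0; transitivity (\sum_(n <- iota 1 M | n \in P) G n).
  rewrite [RHS]bigfs ?iota_uniq ?set_mem_set// => n; rewrite inE => Pn.
  rewrite mem_iota add1n ltnS negb_and -!ltnNge => /orP[|/G0//].
  by rewrite ltnS leqn0 => /eqP n0; move: P0; rewrite -n0.
have -> : iota 1 M = index_iota 1 M.+1 by rewrite /index_iota subn1.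
by rewrite big_mkcond big_add1 big_mkord.
Qed.

Lemma sum_complexE (M : nat) (z : 'I_M -> R[i]) (p q : 'I_M -> R) :
  (forall i, z i = p i +i* q i) -> \sum_i z i = (\sum_i p i) +i* (\sum_i q i).
Proof.
move=> zE; apply: (big_rec3 (fun z p q => z = p +i* q)) => // i z' p' q' _ ->.
by rewrite zE.
Qed.

Lemma mul_complexE (p q r s : R) :
  (p +i* q) * (r +i* s) = (p * r - q * s) +i* (p * s + q * r).
Proof. by []. Qed.

Lemma sqr_modc (p q : R) : modc (p +i* q) ^+ 2 = p ^+ 2 + q ^+ 2.
Proof. by rewrite /modc /= sqr_sqrtr// addr_ge0 ?sqr_ge0. Qed.

(** The weight is nonnegative exactly on the window, so the cutoff in [tent] reproduces the
    restriction to it; at the ends both sides are 0. *)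
Lemma tent_window T y (n : nat) : 0 < T -> 0 < y -> (0 < n)%N ->
  (if n \in window y (y / T) then 1 - `|n%:R - y| / (y / T) else 0) =
  tent T (ln y - ln n%:R).
Proof.
move=> T0 y0 n0; have n0' : 0 < n%:R :> R by rewrite ltr0n.
rewrite /tent opprB expRB !lnK ?posrE//.
have h0 : 0 < y / T by rewrite divr_gt0.
have -> : T * `|n%:R / y - 1| = `|n%:R - y| / (y / T).
  have -> : n%:R / y - 1 = (n%:R - y) / y by field; rewrite gt_eqF.
  rewrite normrM normfV (gtr0_norm y0); field; by rewrite !gt_eqF.
have <- : (`|n%:R - y| / (y / T) <= 1) = (n \in window y (y / T)).
  rewrite ler_pdivrMr// mul1r ler_distl.
  by apply/idP/idP => [h|]; [rewrite inE; split|rewrite inE => -[_]].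
by case: leP => h; [rewrite max_r|rewrite max_l]; rewrite // ?subr_ge0// subr_le0 ltW.
Qed.

Definition re_coeff a (i : nat) : R := complex.Re (a i.+1).
Definition im_coeff a (i : nat) : R := complex.Im (a i.+1).

Section Truncation.
Variables (a : nat -> R[i]) (m : nat).
Hypothesis a0 : forall n, (m.+1 < n)%N -> a n = 0.

Lemma tent_sumE T y : 0 < T -> 0 < y -> tent_sum a y (y / T) =
  tent_series T m (re_coeff a) (ln y) +i* tent_series T m (im_coeff a) (ln y).
Proof.
move=> T0 y0; rewrite /tent_sum (@fsum_positive _ _ _ m.+1); first last.
- by move=> n /a0 ->; rewrite mulr0.
- by case.
apply: sum_complexE => i; rewrite -tent_window// /re_coeff /im_coeff.
case: ifP => _; last by rewrite !mulr0.
by case: (a i.+1) => p q /=; rewrite mul_complexE; congr (_ +i* _); ring.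
Qed.

Lemma dirichlet_polyE t : dirichlet_poly a t =
  (cos_poly m (re_coeff a) t - sin_poly m (im_coeff a) t) +i*
  (sin_poly m (re_coeff a) t + cos_poly m (im_coeff a) t).
Proof.
rewrite /dirichlet_poly (@fsum_positive _ _ _ m.+1); first last.
- by move=> n /a0 ->; rewrite mul0r.
- by [].
rewrite /cos_poly /sin_poly -sumrB -big_split; apply: sum_complexE => i.
rewrite mem_set// /natpow_i /re_coeff /im_coeff.
by case: (a i.+1) => p q /=; rewrite mul_complexE.
Qed.

(** Finitely many n matter, each giving a constant switched on by two linear inequalities in y. *)
Lemma measurable_abs_sum T :
  measurable_fun setT (fun y : R => abs_sum a y (y / T)).
Proof.
rewrite (_ : (fun y : R => _) = fun y => \sum_(i < m.+1)
    if (y - y / T <= i.+1%:R) && (i.+1%:R <= y + y / T)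
    then modc (a i.+1) else 0); last first.
  apply/funext => y; rewrite /abs_sum (@fsum_positive _ _ _ m.+1); first last.
  - move=> n /a0 ->; apply/eqP; rewrite -sqrf_eq0.
    by rewrite -[0 : R[i]]/(0 +i* 0) sqr_modc expr0n addr0.
  - by case.
  apply: eq_bigr => i _; congr (if _ then _ else _).
  by apply/idP/idP => [|h]; rewrite inE => //; case.
apply: measurable_sum => i; apply: measurable_fun_ifT => //.
(* The choices s = -1 and s = 1 give the two ends of the window. *)
have mD (s : R) : measurable_fun setT (fun y : R => y + s * (y / T)).
  apply: continuous_measurable_fun => y; apply: cvgD; first exact: cvg_id.
  by apply: cvgM; [exact: cvg_cst|apply: cvgM; [exact: cvg_id|exact: cvg_cst]].
apply: measurable_and; apply: measurable_fun_ler => //.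
- have := mD (-1); by under eq_fun do rewrite mulN1r.
- have := mD 1; by under eq_fun do rewrite mul1r.
Qed.

End Truncation.
End DirichletTent.

(** * Comparison with the integral over y through y = e^u *)

Section Comparison.
Context {R : realType}.
Variables (T : R) (m : nat).
Implicit Types (x z : nat -> R) (b : R).

Lemma exists_period : 0 < T ->
  exists2 N : nat, (0 < N)%N & ln m.+1%:R + 2 <= pi * N%:R / T.
Proof.
move=> T0; have p0 : 0 < pi :> R by exact: pi_gt0.
have l0 : 0 <= ln m.+1%:R :> R by rewrite ln_ge0// ler1n.
pose B : R := T * (ln m.+1%:R + 2) / pi.
have B0 : 0 <= B by rewrite divr_ge0 ?(ltW p0)// mulr_ge0 ?(ltW T0)//; lra.
exists (Num.bound B).+1 => //.
have /ltW h := archi_boundP B0.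
have hB : B <= (Num.bound B).+1%:R by apply: le_trans h _; rewrite ler_nat.
rewrite ler_pdivlMr// mulrC [leRHS]mulrC -ler_pdivrMr//; exact: hB.
Qed.

(** The integrand of the first integral of the statement, once [x] and [z] are the real and
    imaginary parts of the coefficients. *)
Definition tent_energy x z (y : R) : R :=
  (tent_series T m x (ln y) ^+ 2 + tent_series T m z (ln y) ^+ 2) / y.

Lemma tent_energy_continuous x z :
  {within `[1, +oo[, continuous (tent_energy x z)}.
Proof.
apply: continuous_in_subspaceT => y; rewrite inE/= in_itv/= andbT => y1.
have y0 : 0 < y by exact: lt_le_trans y1.
have cl w : {for y, continuous (fun y => tent_series T m w (ln y) ^+ 2)}.
  apply: (@continuous_comp _ _ _ (@ln R) (fun u => tent_series T m w u ^+ 2)).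
    exact: continuous_ln.
  by apply: continuousM_fun; exact: continuous_tent_series.
apply: cvgM; last by apply: cvgV; [rewrite gt_eqF|exact: cvg_id].
by apply: cvgD; exact: cl.
Qed.

(** The substitution y = e^u turns dy / y into du on [1, e^b], and the integrand is nonnegative on
    the rest of the half-line. *)
Lemma integral_tent_energy_ge x z b : 0 <= b ->
  ((segint 0 b (fun u => tent_series T m x u ^+ 2 + tent_series T m z u ^+ 2))%:E <=
   \int[lebesgue_measure]_(y in `[1%R, +oo[) (tent_energy x z y)%:E)%E.
Proof.
move=> b0; have cE := @tent_energy_continuous x z.
have sub : `[expR 0, expR b] `<=` (`[1, +oo[ : set R).
  by rewrite expR0; apply: subset_itvl; rewrite bnd_simp.
have cS : continuous (fun u => tent_series T m x u ^+ 2 + tent_series T m z u ^+ 2).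
  by apply: continuousD_fun; apply: continuousM_fun; exact: continuous_tent_series.
rewrite segintE// (_ : (\int[_]_(x in _) _ =
    \int[lebesgue_measure]_(y in `[expR 0, expR b]) (tent_energy x z y)%:E)%E);
  last first.
  rewrite (segint_substitution b0 (f := expR)).
  - apply: eq_integral => u _; rewrite /tent_energy expRK mulfVK//.
    by rewrite gt_eqF// expR_gt0.
  - by move=> u v; rewrite ltr_expR.
  - exact: continuous_expR.
  - exact: continuous_subspaceW cE.
apply: ge0_subset_integral => //.
- apply/measurable_EFinP; apply: subspace_continuous_measurable_fun => //.
- move=> y /=; rewrite in_itv/= andbT => y1; rewrite lee_fin divr_ge0 ?addr_ge0 ?sqr_ge0//.
  exact: le_trans y1.
Qed.

(** Write D = D_x + i D_z with real coefficients in each part and use |D|^2 <= 2 |D_x|^2 + 2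
    |D_z|^2. The constant is 5184 = 2 * 9 * 288. *)
Lemma integral_dirichlet_le x z : 11 <= T ->
  exists2 b, 0 <= b &
  segint (- T) T (fun t => (cos_poly m x t - sin_poly m z t) ^+ 2 +
                           (sin_poly m x t + cos_poly m z t) ^+ 2) <=
  5184 * pi * T ^+ 2 *
    segint 0 b (fun u => tent_series T m x u ^+ 2 + tent_series T m z u ^+ 2).
Proof.
move=> T11; have T0 : 0 < T by lra.
have T2 : 2 <= T by lra.
have l0 : 0 <= ln m.+1%:R :> R by rewrite ln_ge0// ler1n.
have p0 : 0 < pi :> R by exact: pi_gt0.
have [N N0 hN] := exists_period T0.
exists (-1 + pi * N%:R / T); first by lra.
set b := -1 + _.
have b1 : 1 <= b by rewrite /b; lra.
have c2 (w : R -> R) : continuous w -> continuous (fun t => w t ^+ 2).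
  by move=> cw; exact: continuousM_fun.
have cc w := c2 _ (@continuous_cos_poly R m w).
have cz w := c2 _ (@continuous_sin_poly R m w).
have ct w := c2 _ (@continuous_tent_series R T m w).
have key w : segint (- T) T (fun t => cos_poly m w t ^+ 2 + sin_poly m w t ^+ 2) <=
    2592 * pi * T ^+ 2 * segint 0 b (fun u => tent_series T m w u ^+ 2).
  apply: (le_trans (mean_square_le w T11 N0 hN)).
  apply: (@le_trans _ _ (288 * pi * T ^+ 2 *
      (9 * segint 0 b (fun u => tent_series T m w u ^+ 2)))).
    apply: ler_wpM2l; last exact: segint_tent_series_neg.
    by rewrite !mulr_ge0// ltW.
  by rewrite le_eqVlt -subr_eq0; apply/orP; left; apply/eqP; ring.
rewrite [X in _ <= _ * X]segintD//.
apply: (@le_trans _ _ (segint (- T) T (fun t =>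
    2 * (cos_poly m x t ^+ 2 + sin_poly m x t ^+ 2) +
    2 * (cos_poly m z t ^+ 2 + sin_poly m z t ^+ 2)))).
  apply: ler_segint.
  - apply: continuousD_fun; apply: c2 => t.
      by apply: cvgB; [exact: continuous_cos_poly|exact: continuous_sin_poly].
    by apply: cvgD; [exact: continuous_sin_poly|exact: continuous_cos_poly].
  - by apply: continuousD_fun; apply: continuousZ_fun; exact: continuousD_fun.
  (* Parallelogram law: the difference is |D_x - i D_z|^2. *)
  - move=> t _; rewrite -subr_ge0.
    set p := cos_poly m x t; set q := sin_poly m z t.
    set r := sin_poly m x t; set s := cos_poly m z t.
    have -> : 2 * (p ^+ 2 + r ^+ 2) + 2 * (s ^+ 2 + q ^+ 2) -
      ((p - q) ^+ 2 + (r + s) ^+ 2) = (p + q) ^+ 2 + (r - s) ^+ 2 by ring.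
    by rewrite addr_ge0 ?sqr_ge0.
rewrite segintD; try by apply: continuousZ_fun; exact: continuousD_fun.
rewrite !segintZ; try exact: continuousD_fun.
have := key x; have := key z; lra.
Qed.

End Comparison.

Theorem mainTheorem2 (R : realType) :
  exists (T0 C K : R) (Delta : R -> R -> R),
    [/\ 1 < T0, 0 < C, 0 < K,
        (forall y T : R, 1 <= y -> T0 <= T ->
           `|Delta y T - y / T| <= K * (y / T ^+ 2)) &
        forall (a : nat -> R[i]) (T : R), fin_supp a -> T0 <= T ->
          measurable_fun (`[1, +oo[ : set R)
            (fun y : R => abs_sum a y (Delta y T) ^+ 2 / y) /\
          (\int[lebesgue_measure]_(t in `[(- T)%R, T])
              (modc (dirichlet_poly a t) ^+ 2)%:E
           <= C%:E *
              ((T ^+ 2)%:E *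
                 \int[lebesgue_measure]_(y in `[1%R, +oo[)
                   (modc (tent_sum a y (y / T)) ^+ 2 / y)%:E
               + \int[lebesgue_measure]_(y in `[1%R, +oo[)
                   (abs_sum a y (Delta y T) ^+ 2 / y)%:E))%E].
Proof.
have C0 : 0 < 5184 * pi :> R by have := pi_gt0 R; lra.
(* The threshold 11 comes from [tent_cos_ge] and 5184 pi from [integral_dirichlet_le]; the deviation
   of Delta from y / T is 0, so any K > 0 would serve. *)
exists 11, (5184 * pi), 1, (fun y T => y / T); split.
- lra.
- exact: C0.
- exact: ltr01.
- move=> y T y1 T11; rewrite subrr normr0 mul1r divr_ge0 ?sqr_ge0//.
  exact: le_trans y1.
move=> a T fa T11; have T0 : 0 < T by lra.
have [m am] := fin_supp_bound fa.
(* The bound is relaxed by one because the real series have [m.+1] terms, for n from 1 to m + 1. *)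
have a0 n : (m.+1 < n)%N -> a n = 0 by move=> /ltnW; exact: am.
have meas : measurable_fun (`[1, +oo[ : set R) (fun y => abs_sum a y (y / T) ^+ 2 / y).
  apply: measurable_funM.
    by apply: measurable_funX; apply: measurable_funTS; exact: (measurable_abs_sum a0).
  apply: subspace_continuous_measurable_fun => //.
  apply: continuous_in_subspaceT => y; rewrite inE/= in_itv/= andbT => y1.
  apply: cvgV; last exact: cvg_id.
  by rewrite gt_eqF// (lt_le_trans _ y1).
split=> //.
have [b b0 hb] := integral_dirichlet_le m (re_coeff a) (im_coeff a) T11.
have yge0 : (0 <= \int[lebesgue_measure]_(y in `[1%R, +oo[)
                   (abs_sum a y (y / T) ^+ 2 / y)%:E)%E.
  apply: integral_ge0 => y /=; rewrite in_itv/= andbT => y1.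
  by rewrite lee_fin divr_ge0 ?sqr_ge0// (le_trans _ y1).
have -> : (\int[lebesgue_measure]_(y in `[1%R, +oo[)
             (modc (tent_sum a y (y / T)) ^+ 2 / y)%:E =
           \int[lebesgue_measure]_(y in `[1%R, +oo[)
             (tent_energy T m (re_coeff a) (im_coeff a) y)%:E)%E.
  apply: eq_integral => y; rewrite inE/= in_itv/= andbT => y1.
  by rewrite (tent_sumE a0)// ?sqr_modc// (lt_le_trans _ y1).
under eq_integral do rewrite (dirichlet_polyE a0) sqr_modc.
rewrite -segintE; last first.
  apply: continuousD_fun; apply: continuousM_fun;
    first [move=> t; apply: cvgB | move=> t; apply: cvgD];
    solve [exact: continuous_cos_poly|exact: continuous_sin_poly].
(* Adding the nonnegative second integral only enlarges the right-hand side. *)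
apply: (@le_trans _ _ ((5184 * pi)%:E * ((T ^+ 2)%:E *
   \int[lebesgue_measure]_(y in `[1%R, +oo[)
             (tent_energy T m (re_coeff a) (im_coeff a) y)%:E))%E); last first.
  by apply: lee_wpmul2l; [rewrite lee_fin ltW|exact: leeDl].
apply: le_trans (_ : ((5184 * pi * T ^+ 2)%:E * _ <= _)%E).
  by move: hb; rewrite -lee_fin EFinM; apply.
rewrite EFinM -muleA; apply: lee_wpmul2l; first by rewrite lee_fin ltW.
apply: lee_wpmul2l; first by rewrite lee_fin sqr_ge0.
exact: integral_tent_energy_ge.
Qed.
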